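(* Let $n\geq 1$, let $X_1,\ldots,X_n$ be independent real random variables with common distribution $\mu$ having finite variance, let $X\sim\mu$, and let $\delta\in(0,1)$. (Additive case) Let $\sigma>0$ and consider noise $\rho = \text{Weibull}(2,\sigma)-\sigma\sqrt{\pi}/2$, i.e. the distribution of $W-\sigma\sqrt{\pi}/2$ with $W\sim\text{Weibull}(2,\sigma)$ (with prior $\nu=\rho$), and let $s>0$ be given by $$s^{2} = \frac{n\left(\mathbf{E}X^{2}+\sigma^{2}(1-\pi/4)\right)}{2\log(\delta^{-1})}.$$ Then the additive-noise estimator $\widehat{x}_{\mathrm{A}}$ built with $\rho$ and $s$ satisfies $$|\widehat{x}_{\mathrm{A}}-\mathbf{E}X| \leq \sqrt{\frac{2\left(\mathbf{E}X^{2}+\sigma^{2}(1-\pi/4)\right)\log(\delta^{-1})}{n}}$$ with probability no less than $1-2\delta$ over the draw of the sample. (Multiplicative case) Assume $\mathbf{E}X^2>0$. Let $k>0$ and consider noise $\rho=\text{Weibull}(k,\sigma(k))$ with $\sigma(k) = (\Gamma(1+1/k))^{-1}$ (with prior $\nu=\text{Weibull}(k,1)$). Write $$c_{k} = \frac{1}{(\Gamma(1+1/k))^{k}} + k\log\Gamma(1+1/k) - 1,$$ and let $s>0$ be given by $$s^{2} = \frac{n\,\Gamma(1+2/k)\,\mathbf{E}X^{2}}{2\,(\Gamma(1+1/k))^{2}\,(c_{k}+\log(\delta^{-1}))}.$$ Then the multiplicative-noise estimator $\widehat{x}_{\mathrm{M}}$ built with $\rho$ and $s$ satisfies $$|\widehat{x}_{\mathrm{M}}-\mathbf{E}X|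 \leq \sqrt{\frac{2\,\Gamma(1+2/k)\,\mathbf{E}X^{2}\,(c_{k}+\log(\delta^{-1}))}{(\Gamma(1+1/k))^{2}\,n}}$$ with probability no less than $1-2\delta$ over the draw of the sample.
   Context: The truncation function $\psi:\mathbb{R}\to\mathbb{R}$ is $$\psi(u) = \begin{cases} u - u^{3}/6, & -\sqrt{2}\leq u\leq \sqrt{2},\\ 2\sqrt{2}/3, & u>\sqrt{2},\\ -2\sqrt{2}/3, & u<-\sqrt{2}.\end{cases}$$ Given a scale $s>0$ and noise $\epsilon_1,\ldots,\epsilon_n$ that are i.i.d. with distribution $\rho$ and independent of the data, the multiplicative-noise and additive-noise estimators are $$\widehat{x}_{\mathrm{M}} = \mathbf{E}_{\epsilon}\left(\frac{s}{n}\sum_{i=1}^{n}\psi\left(\frac{X_i\epsilon_i}{s}\right)\right), \qquad \widehat{x}_{\mathrm{A}} = \mathbf{E}_{\epsilon}\left(\frac{s}{n}\sum_{i=1}^{n}\psi\left(\frac{X_i+\epsilon_i}{s}\right)\right),$$ where $\mathbf{E}_\epsilon$ is expectation over the noise only (data held fixed), so the only remaining randomness is that of the data. $\text{Weibull}(k,\sigma)$, with shape $k>0$ and scale $\sigma>0$, is the distribution on $[0,\infty)$ with $\mathbf{P}\{W\leq\alpha\} = 1-\exp(-(\alpha/\sigma)^{k})$ for $\alpha\geq 0$. $\Gamma$ is Euler's Gamma function. $\mathbf{E}X$ and $\mathbf{E}X^2$ are moments under $\mu$. The prior $\nu$ is an auxiliary distribution that enters neither the estimator nor the conclusion. *)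

(* Defs.v *)
From HB Require Import structures.
From mathcomp Require Import all_boot all_order all_algebra.
From mathcomp Require Import all_classical all_reals all_analysis.
From mathcomp Require Import measurable_realfun.
Import Order.TTheory GRing.Theory Num.Theory numFieldNormedType.Exports.

Set Implicit Arguments.
Unset Strict Implicit.
Unset Printing Implicit Defensive.

Local Open Scope classical_set_scope.
Local Open Scope ring_scope.

Definition psi {R : realType} (u : R) : R :=
  if - Num.sqrt 2 <= u <= Num.sqrt 2 then u - u ^+ 3 / 6
  else if Num.sqrt 2 < u then 2 * Num.sqrt 2 / 3
  else - (2 * Num.sqrt 2 / 3).

(** Euler's Gamma function, meaningful for [0 < z]. *)
Definition Gamma {R : realType} (z : R) : R :=
  \int[lebesgue_measure]_(t in `]0, +oo[) (t `^ (z - 1) * expR (- t)).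

(** [W] is the Weibull(k, sigma) distribution. A cdf determines its distribution,
    so at most one [W] satisfies this; [is_weibull_exists] provides one. *)
Definition is_weibull {R : realType} (k sigma : R)
    (W : probability R R) : Prop :=
  W `[0, +oo[%classic = 1%E /\
  forall a : R, 0 <= a -> W `]-oo, a]%classic = (1 - expR (- ((a / sigma) `^ k)))%:E.

Lemma is_weibull_exists {R : realType} (k sigma : R) :
  0 < k -> 0 < sigma -> exists W, is_weibull k sigma W.
Proof.
move=> k0 s0.
pose E : probability (measurableTypeR R) R :=
  exponential_distribution_exponential_prob__canonical__probability_measure_Probability
    (ltr01 : 0 < (1 : R)).
pose f (x : R) : R := sigma * (Num.max 0 x) `^ k^-1.
have mf : measurable_fun [set: measurableTypeR R] (f : measurableTypeR R -> R).
  have mm : measurable_fun [set: measurableTypeR R]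
      (fun x : measurableTypeR R => Num.max 0 (x : R) : R).
    apply: (@measurable_maxr _ (measurableTypeR R) R setT (cst 0) idfun) => //.
    by move=> _ A mA; rewrite setTI.
  have mp := measurableT_comp (measurable_powR k^-1) mm.
  apply: (@measurable_funM _ (measurableTypeR R) R setT (cst sigma) _ _ mp) => //.
pose f_ : {mfun measurableTypeR R >-> R} := HB.pack f (isMeasurableFun.Build _ _ (measurableTypeR R) R f mf).
have f0 x : 0 <= f x by rewrite mulr_ge0 ?powR_ge0// ltW.
exists (distribution E f_); split.
  have fT : f @^-1` `[0, +oo[%classic = setT :> set (measurableTypeR R).
    by apply/seteqP; split=> x //= _; rewrite in_itv/= f0.
  by rewrite -(probability_setT E) -fT.
move=> a a0; pose b := (a / sigma) `^ k.
have b0 : 0 <= b by exact: powR_ge0.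
have fab x : (f x <= a) = (x <= b).
  rewrite /f mulrC -ler_pdivlMr//.
  have as0 : 0 <= a / sigma by rewrite divr_ge0// ltW.
  have -> : a / sigma = b `^ k^-1 by rewrite /b -powRrM mulfV ?gt_eqF// powRr1.
  have kV : 0 < k^-1 by rewrite invr_gt0.
  have m0 : 0 <= Num.max 0 x by rewrite le_max lexx.
  rewrite (_ : (x <= b) = (Num.max 0 x <= b)); last by rewrite ge_max b0.
  apply/idP/idP => [|h]; last by rewrite ge0_ler_powR// ltW.
  by apply: contraTT; rewrite -!ltNge => h; rewrite gt0_ltr_powR// ?nnegrE.
have fb : f @^-1` `]-oo, a]%classic = `]-oo, b]%classic :> set (measurableTypeR R).
  by apply/seteqP; split=> x /=; rewrite !in_itv/= fab.
transitivity (E `]-oo, b]%classic); first by rewrite -fb.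
have En : E `]-oo, 0%R[%classic = 0%E.
  rewrite /E/= /exponential_prob integral0_eq// => x /=; rewrite in_itv/= => x0.
  by rewrite lt0_exponential_pdf.
have -> : `]-oo, b]%classic = `]-oo, 0[%classic `|` `[0, b]%classic :> set R.
  by apply/seteqP; split=> x /=; rewrite !in_itv/=; case: (ltP x 0) => x0/=;
    [left| right => //|move=> _; exact: le_trans (ltW x0) b0|case].
rewrite measureU//; last first.
  apply/seteqP; split=> x //= []; rewrite !in_itv/= => x0.
  by rewrite leNgt x0.
rewrite [X in (X + _)%E](_ : _ = 0%E) ?add0e; last exact: En.
rewrite -/b; move: b0; rewrite le_eqVlt => /predU1P[<-|b0]; last first.
  by rewrite /E/= exponential_prob_itv0c// mulN1r EFinB.
rewrite oppr0 expR0 subrr /E/= /exponential_prob set_itv1.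
by rewrite integral_set1.
Qed.

Definition mutually_independent {d} {T : measurableType d} {R : realType}
    (P : probability T R) (n : nat) (X : 'I_n -> T -> R) : Prop :=
  forall (J : {set 'I_n}) (B : 'I_n -> set R),
    (forall i, i \in J -> measurable (B i)) ->
    P (\bigcap_(i in [set` J]) (X i @^-1` B i)) =
    (\prod_(i in J) P (X i @^-1` B i))%E.

(** [g_sigma_preimage X] is the sigma-algebra generated by the whole family. *)
Definition independent_families {d} {T : measurableType d} {R : realType}
    (P : probability T R) (m n : nat)
    (X : 'I_m -> T -> R) (Y : 'I_n -> T -> R) : Prop :=
  forall A B : set T, g_sigma_preimage X A -> g_sigma_preimage Y B ->
    P (A `&` B) = (P A * P B)%E.

(** Data and noise live on one probability space. In the two estimators the data
    is frozen at the outcome [t], and the expectation over the outcome [w] acts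
    on the noise alone; when the noise is independent of the data this is the
    conditional expectation given the data. *)
Definition est_mul {d} {T : measurableType d} {R : realType}
    (P : probability T R) (n : nat) (X eps : 'I_n -> T -> R) (s : R) (t : T) : R :=
  fine ('E_P[(fun w => s / n%:R * \sum_(i < n) psi (X i t * eps i w / s))%R])%E.

Definition est_add {d} {T : measurableType d} {R : realType}
    (P : probability T R) (n : nat) (X eps : 'I_n -> T -> R) (s : R) (t : T) : R :=
  fine ('E_P[(fun w => s / n%:R * \sum_(i < n) psi ((X i t + eps i w) / s))%R])%E.

Definition weibull_c {R : realType} (k : R) : R :=
  1 / (Gamma (1 + 1 / k) `^ k) + k * ln (Gamma (1 + 1 / k)) - 1.

(* Main.v *)
(** Write [phi x] for the mean over the noise of [psi (u x / s)], where [u x] is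
    the noisy datum, of mean [x] and second moment [a * x ^+ 2 + b]. Since
    [expR (psi v) <= 1 + v + v ^+ 2 / 2], Jensen's inequality gives
    [expR (phi x) <= 1 + x / s + (a * x ^+ 2 + b) / (2 * s ^+ 2)], and the same
    holds for [- phi] with [- x]. Averaging over the independent data and applying
    Markov's inequality bounds each tail by [expR (- L)], at a deviation
    [(a * EX2 + b) / (2 * s) + s * L / n], which the prescribed [s] minimizes.
    This replaces the PAC-Bayes argument: no Kullback-Leibler term is needed, and
    the constant [weibull_c k], being nonnegative, only enlarges [L]. The Weibull
    moments come from tail integrals, [E (Z `^ q)] being the integral over
    [a >= 0] of [expR (- a `^ (k / q))] when [P (Z > a) = expR (- a `^ k)]; with
    [k = 1] this integral is a Gamma value, with [k / q = 2] the Gaussian one. *)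

Require Import Defs.
From HB Require Import structures.
From mathcomp Require Import all_boot all_order all_algebra.
From mathcomp Require Import all_classical all_reals all_analysis.
From mathcomp Require Import finmap measurable_realfun gauss_integral ring lra.
Import Order.TTheory GRing.Theory Num.Theory numFieldNormedType.Exports.

Set Implicit Arguments.
Unset Strict Implicit.
Unset Printing Implicit Defensive.

Local Open Scope classical_set_scope.
Local Open Scope ring_scope.

(** * The exponential bound on the truncation function *)

Section psi_bounds.
Context {R : realType}.
Implicit Types u : R.

(** Ratio of the quadratic bound to [expR (u - u ^+ 3 / 6)]. Its derivative is a positive factor
    times [u ^+ 3 * (2 + u)], so on [- 2 <= u] it falls, then rises, with minimum 1 at 0. *)
Let F u : R := (1 + u + u ^+ 2 / 2) * expR (u ^+ 3 / 6 - u).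

Let dF u : is_derive u 1 F ((u ^+ 3 * (2 + u) / 4) * expR (u ^+ 3 / 6 - u)).
Proof.
have hh : is_derive u 1 F ((1 + u + u ^+ 2 / 2) *: (expR (u ^+ 3 / 6 - u) *:
    (3%:R * u ^+ 2 / 6 - 1)) + expR (u ^+ 3 / 6 - u) *: (1 + u)).
  rewrite /F; apply: is_derive_eq.
  by move=> *; rewrite /GRing.scale/=; field.
by apply: (is_derive_eq hh); rewrite /GRing.scale/=; field.
Qed.

Let quad_ge1 u : - Num.sqrt 2 <= u <= Num.sqrt 2 ->
  expR (u - u ^+ 3 / 6) <= 1 + u + u ^+ 2 / 2.
Proof.
move=> /andP[u1 u2].
have s2 : Num.sqrt (2:R) <= 2.
  by rewrite -[leRHS]ger0_norm// -sqrtr_sqr ler_sqrt//; lra.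
have D v : derivable F v 1 by have [] := dF v.
have D' v : derive1 F v = (v ^+ 3 * (2 + v) / 4) * expR (v ^+ 3 / 6 - v).
  by rewrite derive1E; have [] := dF v.
have cF : continuous F.
  by move=> v; apply/differentiable_continuous/derivable1_diffP.
have F0 : F 0 = 1 by rewrite /F expr0n/= mul0r subr0 expr0n/= mul0r expR0; lra.
suff : 1 <= F u.
  rewrite /F => h; rewrite -opprB -[leLHS]mulr1 expRN -ler_pdivlMl ?invr_gt0 ?expR_gt0//.
  by rewrite invrK mulrC.
rewrite -F0; have [u0|u0] := leP 0 u.
  apply: (@ger0_derive1_ndecry _ F 0) => //.
    move=> v; rewrite in_itv/= andbT => v0.
    by rewrite D' mulr_ge0 ?expR_ge0// divr_ge0// mulr_ge0 ?exprn_ge0//; lra.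
  exact: continuous_subspaceT.
apply: (@ler0_derive1_nincr _ F (- 2) 0) => //.
- move=> v; rewrite in_itv/= => /andP[v0 v1].
  have v3 : v ^+ 3 <= 0 by rewrite exprS mulr_le0_ge0 ?sqr_ge0// ltW.
  by rewrite D' mulr_le0_ge0 ?expR_ge0// mulr_le0_ge0// mulr_le0_ge0//; lra.
- exact: continuous_subspaceT.
- by rewrite (le_trans _ u1)// lerN2.
- exact: ltW.
Qed.

Lemma psiN u : psi (- u) = - psi u.
Proof.
have s0 := sqrtr_ge0 (2 : R); rewrite /psi lerN2 lerNl andbC.
case: ifPn => [_|]; first lra.
case: (ltP (Num.sqrt 2) (- u)) => ?; case: (ltP (Num.sqrt 2) u) => ?; lra.
Qed.

(** Beyond the thresholds [psi] is frozen at its endpoint values, while the parabola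
    [1 + u + u ^+ 2 / 2], with vertex at -1, grows outward because [1 <= Num.sqrt 2]. Hence the
    interval between them suffices. *)
Lemma expR_psi_le u : expR (psi u) <= 1 + u + u ^+ 2 / 2.
Proof.
have s2 : Num.sqrt (2:R) ^+ 2 = 2 by rewrite sqr_sqrtr.
have s0 : 1 <= Num.sqrt (2:R) by rewrite -[leLHS]sqrtr1 ler_sqrt; lra.
have s3 : Num.sqrt (2:R) ^+ 3 = 2 * Num.sqrt 2 by rewrite exprSr s2.
rewrite /psi; case: ifPn => [|]; first exact: quad_ge1.
case: ifPn => [us _|]; last rewrite -leNgt => us.
  apply: le_trans (_ : 1 + Num.sqrt 2 + Num.sqrt 2 ^+ 2 / 2 <= _); last by nra.
  apply: le_trans (@quad_ge1 (Num.sqrt 2) _); last by apply/andP; split; lra.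
  by rewrite ler_expR s3; lra.
rewrite negb_and -!ltNge => /orP[u1|]; last by rewrite ltNge us.
apply: le_trans (_ : 1 + - Num.sqrt 2 + (- Num.sqrt 2) ^+ 2 / 2 <= _); last first.
  by rewrite sqrrN; nra.
apply: le_trans (@quad_ge1 (- Num.sqrt 2) _); last by apply/andP; split; lra.
by rewrite ler_expR exprNn s3; lra.
Qed.

Lemma expRN_psi_le u : expR (- psi u) <= 1 - u + u ^+ 2 / 2.
Proof. by rewrite -psiN (le_trans (expR_psi_le _))// sqrrN. Qed.

Lemma psi_le1 u : `|psi u| <= 1.
Proof.
have s2 : Num.sqrt (2:R) ^+ 2 = 2 by rewrite sqr_sqrtr.
have s0 : 1 <= Num.sqrt (2:R) by rewrite -[leLHS]sqrtr1 ler_sqrt; lra.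
have s3 : 2 * Num.sqrt (2:R) / 3 <= 1 by nra.
wlog u0 : u / 0 <= u => [h|].
  by have [/h//|u0] := leP 0 u; rewrite -normrN -psiN h// oppr_ge0 ltW.
have p0 : 0 <= psi u.
  rewrite /psi; case: ifPn => [/andP[_ us]|].
    have -> : u - u ^+ 3 / 6 = u * (1 - u ^+ 2 / 6) by field.
    by rewrite mulr_ge0//; nra.
  by case: (ltP (Num.sqrt 2) u) => ?; lra.
rewrite ger0_norm// /psi; case: ifPn => [/andP[_ us]|]; last by case: (ltP (Num.sqrt 2) u) => ?; lra.
(* The maximum is at the threshold: expanded, this product is six times
   [2 * Num.sqrt 2 / 3 - (u - u ^+ 3 / 6)]. *)
have : 0 <= (Num.sqrt 2 - u) ^+ 2 * (2 * Num.sqrt 2 + u) by rewrite mulr_ge0 ?sqr_ge0//; lra.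
have -> : (Num.sqrt 2 - u) ^+ 2 * (2 * Num.sqrt 2 + u) =
  2 * (Num.sqrt 2 ^+ 2 * Num.sqrt 2) - 3 * Num.sqrt 2 ^+ 2 * u + u ^+ 3 by ring.
rewrite s2; lra.
Qed.

Lemma measurable_psi : measurable_fun [set: R] (@psi R).
Proof.
apply: measurable_fun_ifT.
- apply: measurable_and; apply: measurable_fun_ler => //.
- apply: measurable_funB => //; apply: measurable_funM => //.
- apply: measurable_fun_ifT => //; exact: measurable_fun_ltr.
Qed.

End psi_bounds.

(** * Integrals of a function of a variable against a weight *)

Section weighted_law.
Context d (T : measurableType d) (R : realType).
Variables (mu : {measure set T -> \bar R}) (nu : {measure set R -> \bar R}).
Local Open Scope ereal_scope.
Import HBNNSimple.

(** Linearity settles simple [f], and monotone convergence the rest. With [G] a density this turns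
    an integral into an expectation; with [G] a product of other factors it expresses
    independence. *)
Lemma ge0_integral_weighted_law (Y G : T -> R) (c : R) (f : R -> R) :
  measurable_fun setT Y ->
  measurable_fun setT G -> (forall t, 0 <= G t)%R -> (0 <= c)%R ->
  measurable_fun setT f -> (forall y, 0 <= f y)%R ->
  (forall B : set R, measurable B ->
    \int[mu]_t (G t * \1_(Y @^-1` B) t)%:E = c%:E * nu B) ->
  \int[mu]_t (G t * f (Y t))%:E = c%:E * \int[nu]_y (f y)%:E.
Proof.
move=> mY mG G0 c0 mf f0 GB.
pose f_ := nnsfun_approx (@measurableT _ R) (proj2 (measurable_EFinP _ f) mf).
have f_cvg y : (f_ n y)%:E @[n --> \oo] --> (f y)%:E.
  by apply: cvg_nnsfun_approx => // z _; rewrite lee_fin.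
have f_nd y : {homo (fun n => f_ n y) : m n / (m <= n)%N >-> (m <= n)%R}.
  by move=> m n mn; exact/lefP/nd_nnsfun_approx.
have simple n : \int[mu]_t (G t * f_ n (Y t))%:E = c%:E * \int[nu]_y (f_ n y)%:E.
  have mB k : measurable (Y @^-1` (f_ n @^-1` [set k])).
    by rewrite -[X in measurable X]setTI; apply: mY => //; exact: measurable_sfunP.
  have fE y : f_ n y = (\sum_(k <- fset_set (range (f_ n)))
      (k * \1_(f_ n @^-1` [set k]) y))%R.
    by rewrite fimfunE fsbig_finite.
  (* A negative level [k] has an empty preimage, so its term vanishes. *)
  have k0 k y : (0 <= k * \1_(f_ n @^-1` [set k]) y)%R.
    rewrite indicE; case: (boolP (y \in _)) => [/set_mem <-|_]; last by rewrite mulr0.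
    by rewrite mulr1.
  have mI k : measurable_fun setT (\1_(Y @^-1` (f_ n @^-1` [set k])) : T -> R).
    exact: measurable_indic.
  transitivity (\int[mu]_t \sum_(k <- fset_set (range (f_ n)))
      (G t * (k * \1_(Y @^-1` (f_ n @^-1` [set k])) t))%:E).
    by apply: eq_integral => t _; rewrite fE mulr_sumr sumEFin.
  rewrite ge0_integral_sum//; last 2 first.
    - by move=> k; apply/measurable_EFinP; do 2 apply: measurable_funM => //.
    - by move=> k t _; rewrite lee_fin mulr_ge0// (k0 k (Y t)).
  transitivity (c%:E * \int[nu]_y \sum_(k <- fset_set (range (f_ n)))
      (k * \1_(f_ n @^-1` [set k]) y)%:E); last first.
    by congr (_ * _); apply: eq_integral => t _; rewrite fE sumEFin.
  rewrite ge0_integral_sum//; last 2 first.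
    - move=> k; apply/measurable_EFinP.
      by apply: measurable_funM => //; exact: measurable_indic.
    - by move=> k t _; rewrite lee_fin.
  rewrite ge0_sume_distrr; last by move=> k _; apply: integral_ge0 => t _; rewrite lee_fin.
  apply: eq_big_seq => k; rewrite in_fset_set// => /set_mem[y _ kE].
  have {}k0 : (0 <= k)%R by rewrite -kE.
  under eq_integral do rewrite mulrCA EFinM.
  rewrite ge0_integralZl//=.
  - rewrite GB; last exact: measurable_sfunP.
    under [in RHS]eq_integral do rewrite EFinM.
    rewrite ge0_integralZl//; first by rewrite integral_indic// setIT muleCA.
    by apply/measurable_EFinP; exact: measurable_indic.
  - by apply/measurable_EFinP; exact: measurable_funM.
  - by move=> t _; rewrite lee_fin mulr_ge0// indicE.
have lim1 : \int[mu]_t (G t * f_ n (Y t))%:E @[n --> \oo] --> \int[mu]_t (G t * f (Y t))%:E.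
  rewrite [X in _ --> X](_ : _ = \int[mu]_t limn (fun n => (G t * f_ n (Y t))%:E)).
    apply: cvg_monotone_convergence => //.
  - move=> n; apply/measurable_EFinP; apply: measurable_funM => //.
    by apply: measurableT_comp => //; exact: measurable_funP.
  - by move=> n t _; rewrite lee_fin mulr_ge0.
  - by move=> t _ m n mn; rewrite lee_fin ler_wpM2l// f_nd.
  apply: eq_integral => t _; apply/esym/cvg_lim => //.
  by under eq_fun do rewrite EFinM; rewrite EFinM; exact: cvgeZl.
have lim2 : (c%:E * \int[nu]_y (f_ n y)%:E) @[n --> \oo] --> c%:E * \int[nu]_y (f y)%:E.
  apply: cvgeZl => //.
  rewrite [X in _ --> X](_ : _ = \int[nu]_t limn (fun n => (f_ n t)%:E)).
    apply: cvg_monotone_convergence => //.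
  - by move=> n; apply/measurable_EFinP; exact: measurable_funP.
  - by move=> n t _; rewrite lee_fin.
  - by move=> t _ m n mn; rewrite lee_fin f_nd.
  by apply: eq_integral => t _; apply/esym/cvg_lim.
rewrite -(cvg_lim _ lim1)// -(cvg_lim _ lim2)//.
by under eq_fun do rewrite simple.
Qed.

End weighted_law.

(** * The product formula for independent variables *)

Section independent_product.
Context d (T : measurableType d) (R : realType) (P : probability T R).
Variables (n : nat) (X : 'I_n -> {RV P >-> R}) (f : 'I_n -> R -> R).
Hypothesis indX : mutually_independent P (fun i => X i : T -> R).
Hypothesis mf : forall i, measurable_fun setT (f i).
Hypothesis f0 : forall i y, 0 <= f i y.
Hypothesis foo : forall i, (\int[P]_t (f i (X i t))%:E < +oo)%E.

Let m i := fine (\int[P]_t (f i (X i t))%:E)%E.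

Let m_ge0 i : 0 <= m i.
Proof. by rewrite fine_ge0// integral_ge0// => t _; rewrite lee_fin. Qed.

Let mE i : (\int[P]_t (f i (X i t))%:E)%E = (m i)%:E.
Proof.
by rewrite fineK// ge0_fin_numE// integral_ge0// => t _; rewrite lee_fin.
Qed.

Let cap (J : {set 'I_n}) (B : 'I_n -> set R) : set T :=
  \bigcap_(i in [set` J]) (X i @^-1` B i).

Let measurable_cap J B : (forall i, measurable (B i)) -> measurable (cap J B).
Proof.
move=> mB; apply: fin_bigcap_measurable; first exact: finite_finset.
by move=> i _; rewrite -[X in measurable X]setTI; apply: measurable_funP.
Qed.

(** Independence is given for events only, so events are replaced by functions one index at a time:
    [r] lists the indices carrying a function, [J] those carrying an event. Testing the head factor
    on a set [B0] moves its index into [J], where the induction hypothesis applies. *)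
Let integral_prod_cap (r : seq 'I_n) (J : {set 'I_n}) (B : 'I_n -> set R) :
  uniq r -> (forall i, i \in r -> i \notin J) -> (forall i, measurable (B i)) ->
  (\int[P]_t ((\prod_(i <- r) f i (X i t)) * \1_(cap J B) t)%:E
    = (\prod_(i <- r) m i)%:E * P (cap J B))%E.
Proof.
elim: r J B => [|i r IH] J B.
  move=> _ _ mB; under eq_integral do rewrite big_nil mul1r.
  by rewrite big_nil mul1e integral_indic ?setIT//; exact: measurable_cap.
move=> /=/andP[ir ur] rJ mB.
have rJ' j : j \in r -> j \notin J by move=> jr; rewrite rJ// inE jr orbT.
have iJ : i \notin J by rewrite rJ// mem_head.
have mI : measurable_fun setT (\1_(cap J B) : T -> R).
  by apply: measurable_indic; exact: measurable_cap.
pose G t := (\prod_(j <- r) f j (X j t)) * \1_(cap J B) t.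
pose c := (\prod_(j <- r) m j) * fine (P (cap J B)).
have PJ : (P (cap J B) = (fine (P (cap J B)))%:E)%E.
  by rewrite fineK// fin_num_measure//; exact: measurable_cap.
rewrite big_cons PJ -EFinM -mulrA mulrC -/c EFinM -mE.
transitivity (\int[P]_t (G t * f i (X i t))%:E)%E.
  by apply: eq_integral => t _; rewrite big_cons -mulrA mulrC.
have -> : (\int[P]_t (f i (X i t))%:E = \int[distribution P (X i)]_y (f i y)%:E)%E.
  rewrite ge0_integral_distribution//; first exact/measurable_EFinP.
  by move=> y; rewrite lee_fin.
apply: ge0_integral_weighted_law => //.
- apply: measurable_funM => //; apply: measurable_prod => j _.
  by apply: measurableT_comp => //; exact: measurable_funP.
- by move=> t; rewrite mulr_ge0// prodr_ge0.
- by rewrite mulr_ge0// ?prodr_ge0// fine_ge0.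
move=> B0 mB0.
(* [B'] puts [B0] at the new index; as [i] is not in [J], no event already present is
   overwritten. *)
pose B' j := if j == i then B0 else B j.
have mB' j : measurable (B' j) by rewrite /B'; case: ifP.
have capE : cap J B `&` X i @^-1` B0 = cap (i |: J) B'.
  apply/seteqP; split => [t [h hi] j /=|t h].
    by rewrite !inE /B' => /predU1P[->|jJ]; [rewrite eqxx|case: eqP => [->|_]//; exact: h].
  split; last by have := h i; rewrite /B'/= eqxx; apply; rewrite /= !inE eqxx.
  move=> j /= jJ; have := h j; rewrite /B'/= !inE jJ orbT => /(_ erefl).
  by case: eqP => // ji; move: iJ; rewrite -ji jJ.
transitivity (\int[P]_t ((\prod_(j <- r) f j (X j t)) * \1_(cap (i |: J) B') t)%:E)%E.
  by apply: eq_integral => t _; rewrite -capE indicI/= mulrA.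
rewrite IH//; last first.
  by move=> j jr; rewrite !inE negb_or rJ'// andbT; apply: contraNneq ir => <-.
rewrite /c EFinM -PJ -muleA; congr (_ * _)%E.
rewrite indX ?big_setU1//= muleC; congr (_ * _)%E; last by rewrite /B' eqxx.
rewrite /cap indX//; apply: eq_bigr => j jJ.
by rewrite /B'; case: eqP => // ji; move: iJ; rewrite -ji jJ.
Qed.

Lemma ge0_integral_indep_prod :
  (\int[P]_t (\prod_(i < n) f i (X i t))%:E
    = \prod_(i < n) \int[P]_t (f i (X i t))%:E)%E.
Proof.
have := @integral_prod_cap (index_enum 'I_n) finset.set0 (fun=> setT)
  (index_enum_uniq _) _ (fun=> measurableT).
have -> : cap finset.set0 (fun=> setT) = setT.
  by apply/seteqP; split=> // t _ i _.
rewrite probability_setT mule1 indicT => h.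
under [RHS]eq_bigr do rewrite mE.
rewrite prodEFin -h; last by move=> i _; rewrite inE.
by apply: eq_integral => t _; rewrite /= mulr1.
Qed.

End independent_product.

(** * Bounded variables: integrability, linearity, Jensen's inequality *)

Section bounded_integrals.
Context d (T : measurableType d) (R : realType) (P : probability T R).
Implicit Types h : T -> R.

Lemma bounded_integrable h (M : R) : measurable_fun setT h ->
  (forall t, `|h t| <= M) -> P.-integrable setT (EFin \o h).
Proof.
move=> mh hM; apply: (le_integrable _ _ _ (finite_measure_integrable_cst P M measurableT)) => //.
  exact/measurable_EFinP.
by move=> t _ /=; rewrite lee_fin (le_trans (hM t))// ler_norm.
Qed.

Lemma fine_integral_affine h (a b : R) : P.-integrable setT (EFin \o h) ->
  (\int[P]_t (a + b * h t)%:E = (a + b * fine (\int[P]_t (h t)%:E))%:E)%E.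
Proof.
move=> ih; have ifin : (\int[P]_t (h t)%:E)%E \is a fin_num.
  exact: integrable_fin_num.
have ic : P.-integrable setT (EFin \o cst a).
  exact: finite_measure_integrable_cst.
have ib : P.-integrable setT (EFin \o (fun t => b * h t)).
  rewrite (_ : _ \o _ = (fun t => b%:E * (h t)%:E)%E)//; exact: integrableZl.
rewrite (@integralD_EFin _ _ _ P setT _ (cst a) (fun t => b * h t))//.
have -> : (\int[P]_t (EFin \o cst a) t = a%:E)%E.
  by rewrite -[RHS](@expectation_cst _ _ _ P) unlock.
rewrite EFinD; congr (_ + _)%E.
rewrite -[LHS]/(\int[P]_t (b%:E * (h t)%:E))%E.
by rewrite integralZl// EFinM fineK.
Qed.

Lemma expR_integral_le h (M B : R) : measurable_fun setT h ->
  (forall t, `|h t| <= M) -> (\int[P]_t (expR (h t))%:E <= B%:E)%E ->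
  expR (fine (\int[P]_t (h t)%:E)) <= B.
Proof.
move=> mh hM hB; rewrite -lee_fin; apply: le_trans hB.
have ih := bounded_integrable mh hM.
set m := fine _.
(* The tangent to the exponential at the mean lies below it. *)
have -> : (expR m)%:E = (\int[P]_t (expR m * (1 - m) + expR m * h t)%:E)%E.
  by rewrite fine_integral_affine// -/m; congr EFin; ring.
apply: le_integral => //.
- apply: (@bounded_integrable _ (`|expR m * (1 - m)| + expR m * M)).
    by apply: measurable_funD => //; exact: measurable_funM.
  move=> t; rewrite (le_trans (ler_normD _ _))// lerD2l normrM.
  by rewrite ger0_norm ?expR_ge0// ler_wpM2l ?expR_ge0.
- apply: (@bounded_integrable _ (expR M)); first exact: measurableT_comp.
  by move=> t; rewrite ger0_norm ?expR_ge0// ler_expR (le_trans (ler_norm _)).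
- move=> t _; rewrite lee_fin -mulrDr -[h t in leRHS](subrK m) expRD mulrC.
  rewrite ler_wpM2r ?expR_ge0//.
  by rewrite (_ : 1 - m + h t = 1 + (h t - m)); [exact: expR_ge1Dx|ring].
Qed.

Lemma fine_integral_scaled_sum (n : nat) (c M : R) (h : 'I_n -> T -> R) :
  (forall i, measurable_fun setT (h i)) -> (forall i t, `|h i t| <= M) ->
  fine (\int[P]_t (c * \sum_(i < n) h i t)%:E)%E =
  c * \sum_(i < n) fine (\int[P]_t (h i t)%:E)%E.
Proof.
move=> mh hM; have ih i := bounded_integrable (mh i) (hM i).
under eq_integral do rewrite EFinM -sumEFin.
have ihs : P.-integrable setT (fun t => \sum_(i < n) (h i t)%:E)%E.
  by apply: integrable_sum => // i _; exact: ih.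
rewrite integralZl//.
rewrite integral_sum// (eq_bigr (fun i => (fine (\int[P]_t (h i t)%:E))%:E))%E.
  by rewrite sumEFin.
by move=> i _; rewrite fineK// (integrable_fin_num measurableT (ih i)).
Qed.

End bounded_integrals.

(** * A Chernoff bound for independent sums *)

Section chernoff_bound.
Context d (T : measurableType d) (R : realType) (P : probability T R).

(** The exponential moment of the sum factorizes, and [1 + v <= expR v] bounds it by
    [expR (n%:R * v)]. The first term of the threshold cancels this, leaving [expR (- L)]. *)
Lemma indep_sum_tail (n : nat) (X : 'I_n -> {RV P >-> R})
    (phi : 'I_n -> R -> R) (v L : R) :
  mutually_independent P (fun i => X i : T -> R) ->
  (forall i, measurable_fun setT (phi i)) ->
  (forall i, (\int[P]_t (expR (phi i (X i t)))%:E <= (1 + v)%:E)%E) ->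
  (P [set t | (n%:R * v + L <= \sum_(i < n) phi i (X i t))%R] <= (expR (- L))%:E)%E.
Proof.
move=> indX mphi hv.
have mS : measurable_fun setT (fun t => \sum_(i < n) phi i (X i t)).
  by apply: measurable_sum => i; apply: measurableT_comp => //; exact: measurable_funP.
pose S : {RV P >-> R} := HB.pack (fun t => \sum_(i < n) phi i (X i t))
  (isMeasurableFun.Build _ _ _ _ _ mS).
(* The Chernoff parameter is 1: any scaling or sign is left to [phi]. *)
have := @chernoff _ _ _ P S 1 (n%:R * v + L) ltr01.
rewrite mul1r => /le_trans; apply.
have -> : ('M_P S 1 = \int[P]_t (\prod_(i < n) expR (phi i (X i t)))%:E)%E.
  rewrite /mmt_gen_fun unlock; apply: eq_integral => t _ /=.
  by rewrite mulr1 expR_sum.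
rewrite (@ge0_integral_indep_prod _ _ _ P n X (fun i y => expR (phi i y)))//; last 2 first.
- by move=> i; exact: measurableT_comp.
- by move=> i; rewrite (le_lt_trans (hv i))// ltry.
have : (\prod_(i < n) \int[P]_t (expR (phi i (X i t)))%:E <= (expR v ^+ n)%:E)%E.
  rewrite (_ : (expR v ^+ n)%:E = \prod_(i < n) (expR v)%:E)%E; last first.
    by rewrite prodEFin prodr_const card_ord.
  (* Multiplying inequalities between extended reals needs nonnegative factors, so the sign is
     carried through the induction. *)
  suff [] : (0 <= \prod_(i < n) \int[P]_t (expR (phi i (X i t)))%:E /\
      \prod_(i < n) \int[P]_t (expR (phi i (X i t)))%:E <=
      \prod_(i < n) (expR v)%:E)%E by [].
  elim/big_ind2: _ => [|x1 x2 y1 y2 [? ?] [? ?]|i _].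
  - by rewrite lee_fin.
  - by split; [exact: mule_ge0|exact: lee_pmul].
  - split; first by apply: integral_ge0 => t _; rewrite lee_fin expR_ge0.
    by rewrite (le_trans (hv i))// lee_fin expR_ge1Dx.
move=> h; apply: (le_trans (lee_wpmul2r _ h)); first by rewrite lee_fin expR_ge0.
by rewrite -EFinM lee_fin -expRM_natl -expRD ler_expR; lra.
Qed.

End chernoff_bound.

(** * Deviation of the noise-averaged mean *)

Section smoothed_mean.
Context d (T : measurableType d) (R : realType) (P : probability T R).

(** Integrability is recorded along with the values because linearity of the integral relies on
    it. *)
Definition has_moments (Y : T -> R) (y1 y2 : R) : Prop :=
  [/\ P.-integrable setT (EFin \o Y), P.-integrable setT (EFin \o (fun t => Y t ^+ 2)),
      (\int[P]_t (Y t)%:E = y1%:E)%E & (\int[P]_t (Y t ^+ 2)%:E = y2%:E)%E].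

Lemma integral_quadratic (Y : T -> R) (y1 y2 c0 c1 c2 : R) : has_moments Y y1 y2 ->
  P.-integrable setT (EFin \o (fun t => c0 + c1 * Y t + c2 * Y t ^+ 2)) /\
  (\int[P]_t (c0 + c1 * Y t + c2 * Y t ^+ 2)%:E = (c0 + c1 * y1 + c2 * y2)%:E)%E.
Proof.
move=> [iY iY2 EY EY2].
have iZ (c : R) (f : T -> R) : P.-integrable setT (EFin \o f) ->
    P.-integrable setT (EFin \o (fun t => c * f t)).
  by move=> ?; rewrite (_ : _ \o _ = (fun t => c%:E * (f t)%:E)%E)//; exact: integrableZl.
have i1 : P.-integrable setT (EFin \o (fun t => c0 + c1 * Y t)).
  rewrite (_ : _ \o _ = ((EFin \o cst c0) \+ (EFin \o (fun t => c1 * Y t)%R))%E)//.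
  by apply: integrableD => //; [exact: finite_measure_integrable_cst|exact: iZ].
split.
  rewrite (_ : _ \o _ = ((EFin \o (fun t => c0 + c1 * Y t)%R) \+
    (EFin \o (fun t => c2 * Y t ^+ 2)%R))%E)//.
  by apply: integrableD => //; exact: iZ.
rewrite (@integralD_EFin _ _ _ P setT measurableT (fun t => c0 + c1 * Y t)
  (fun t => c2 * Y t ^+ 2))//; last exact: iZ.
have := @fine_integral_affine _ _ _ P Y c0 c1 iY; rewrite EY => ->.
rewrite -[X in (_ + X)%E]/(\int[P]_t (c2%:E * (Y t ^+ 2)%:E))%E.
by rewrite integralZl// EY2 EFinD EFinM.
Qed.

Lemma measurable_fine_integral (h : R -> T -> R) (M : R) :
  measurable_fun setT (fun z : R * T => h z.1 z.2) ->
  (forall x t, `|h x t| <= M) ->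
  measurable_fun setT (fun x => fine (\int[P]_t (h x t)%:E)%E).
Proof.
move=> mh hM.
have mhx x : measurable_fun setT (h x).
  by have := measurableT_comp mh (measurable_pair1 x).
(* Tonelli needs a nonnegative integrand. *)
rewrite (_ : (fun _ => _) =
  (fun x => fine (\int[P]_t (M + 1 * h x t)%:E)%E - M)); last first.
  apply/funext => x; rewrite fine_integral_affine; last exact: bounded_integrable (hM x).
  by rewrite /= mul1r addrC addKr.
apply: measurable_funB => //; apply: (measurableT_comp (@fine_measurable R setT measurableT)).
apply: (@measurable_fun_fubini_tonelli_F _ _ (measurableTypeR R) T R P
  (fun z => (M + 1 * h z.1 z.2)%:E)).
  by apply/measurable_EFinP; apply: measurable_funD => //; exact: measurable_funM.
move=> z; rewrite lee_fin mul1r -lerBlDl sub0r.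
by have := hM z.1 z.2; rewrite ler_norml => /andP[].
Qed.

(** Covers both noise models: [u i x] is the datum [x] with its noise. Addition gives [a = 1] and
    [b] the noise variance; multiplication gives [b = 0] and [a] the second moment of noise of mean
    1. The equation for [s] balances [(a * m2 + b) / (2 * s)] against [s * L / n%:R], so the
    deviation is twice the latter. *)
Lemma smoothed_mean_deviation (n : nat) (X : 'I_n -> {RV P >-> R})
    (u : 'I_n -> R -> T -> R) (m1 m2 a b s L delta : R) :
  (0 < n)%N -> 0 < s -> 0 < L -> expR (- L) <= delta ->
  mutually_independent P (fun i => X i : T -> R) ->
  (forall i, has_moments (X i) m1 m2) ->
  (forall i, measurable_fun setT (fun z : R * T => u i z.1 z.2)) ->
  (forall i x, has_moments (u i x) x (a * x ^+ 2 + b)) ->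
  s ^+ 2 = n%:R * (a * m2 + b) / (2 * L) ->
  ((1 - 2 * delta)%:E <=
   P [set t | `|fine (\int[P]_w (s / n%:R * \sum_(i < n) psi (u i (X i t) w / s))%:E) - m1|
              <= Num.sqrt (2 * (a * m2 + b) * L / n%:R)]%R)%E.
Proof.
move=> n0 s0 L0 Ldelta indX Xmom mu umom sE.
have nR0 : 0 < n%:R :> R by rewrite ltr0n.
have VE : a * m2 + b = 2 * L * s ^+ 2 / n%:R.
  by rewrite sE; field; rewrite !gt_eqF.
(* At the prescribed scale the radicand is a perfect square. *)
have -> : Num.sqrt (2 * (a * m2 + b) * L / n%:R) = 2 * L * s / n%:R.
  rewrite VE (_ : _ / _ = (2 * L * s / n%:R) ^+ 2); last by field; rewrite gt_eqF.
  by rewrite sqrtr_sqr ger0_norm// divr_ge0 ?ltW// !mulr_gt0.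
pose h i x w := psi (u i x w / s).
have mh i : measurable_fun setT (fun z : R * T => h i z.1 z.2).
  by apply: (measurableT_comp measurable_psi); exact: measurable_funM.
have mhx i x : measurable_fun setT (h i x).
  by have := measurableT_comp (mh i) (measurable_pair1 x).
have h1 i x w : `|h i x w| <= 1 by exact: psi_le1.
pose phi i x := fine (\int[P]_w (h i x w)%:E)%E.
have mphi i : measurable_fun setT (phi i) by exact: measurable_fine_integral (h1 i).
(* The sign [e], equal to 1 or -1, lets one argument serve both tails. Jensen's inequality moves the
   exponential inside the noise average, where the bound on [psi] applies; the result is quadratic
   in [x], ready to be averaged over the data. *)
have phi_le (e : R) i x : e ^+ 2 = 1 -> (forall y, expR (e * psi y) <= 1 + e * y + y ^+ 2 / 2) ->
    expR (e * phi i x) <= (1 + b / (2 * s ^+ 2)) + e / s * x + a / (2 * s ^+ 2) * x ^+ 2.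
  move=> e2 epsi.
  have e1 : `|e| <= 1.
    by rewrite -(@expr_le1 _ 2)// -normrX e2 normr1.
  have ih := bounded_integrable P (mhx i x) (h1 i x).
  have -> : e * phi i x = fine (\int[P]_w (e * h i x w)%:E)%E.
    rewrite -[X in _ = fine X]/(\int[P]_w (e%:E * (h i x w)%:E))%E integralZl//.
    by rewrite fineM// (integrable_fin_num measurableT ih).
  apply: (@expR_integral_le _ _ _ P _ 1).
  - exact: measurable_funM.
  - by move=> t; rewrite normrM mulr_ile1.
  have [iq Eq] := @integral_quadratic (u i x) x (a * x ^+ 2 + b) 1 (e / s)
    (1 / (2 * s ^+ 2)) (umom i x).
  rewrite (_ : (1 + b / _) + _ + _ =
    1 + e / s * x + 1 / (2 * s ^+ 2) * (a * x ^+ 2 + b)); last first.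
    by field; rewrite gt_eqF.
  rewrite -Eq; apply: le_integral => //.
    apply: (@bounded_integrable _ _ _ P _ (expR 1)).
      by apply: measurableT_comp => //; exact: measurable_funM.
    move=> t; rewrite ger0_norm ?expR_ge0// ler_expR (le_trans (ler_norm _))//.
    by rewrite normrM mulr_ile1.
  move=> w _; rewrite lee_fin (le_trans (epsi _))// le_eqVlt; apply/orP; left.
  by apply/eqP; field; rewrite gt_eqF.
(* The second-moment term [n%:R * (a * m2 + b) / (2 * s ^+ 2)] equals [L] by the choice of [s]; with
   the [L] of the tail bound it makes [2 * L]. *)
have tail (e : R) : e ^+ 2 = 1 -> (forall y, expR (e * psi y) <= 1 + e * y + y ^+ 2 / 2) ->
    (P [set t | (n%:R * (e * m1 / s) + 2 * L <= e * \sum_(i < n) phi i (X i t))%R]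
      <= delta%:E)%E.
  move=> e2 epsi; apply: (@le_trans _ _ (expR (- L))%:E); last by rewrite lee_fin.
  have := @indep_sum_tail _ _ _ P n X (fun i x => e * phi i x)
    (e * m1 / s + (a * m2 + b) / (2 * s ^+ 2)) L indX _ _.
  under eq_set do rewrite -mulr_sumr.
  rewrite (_ : _ * _ + L = n%:R * (e * m1 / s) + 2 * L); last first.
    by rewrite VE; field; rewrite !gt_eqF.
  apply; first by move=> i; exact: measurable_funM.
  move=> i.
  have [iq Eq] := @integral_quadratic (X i) m1 m2 (1 + b / (2 * s ^+ 2)) (e / s)
    (a / (2 * s ^+ 2)) (Xmom i).
  rewrite (_ : 1 + (e * m1 / s + _) =
    1 + b / (2 * s ^+ 2) + e / s * m1 + a / (2 * s ^+ 2) * m2); last first.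
    by field; rewrite gt_eqF.
  rewrite -Eq; apply: ge0_le_integral => //.
  - apply/measurable_EFinP; apply: measurableT_comp => //; apply: measurable_funM => //.
    by apply: measurableT_comp => //; exact: measurable_funP.
  - by move/integrableP : iq => [].
  - by move=> t _; rewrite lee_fin phi_le.
have mS : measurable_fun setT (fun t => \sum_(i < n) phi i (X i t)).
  by apply: measurable_sum => i; apply: measurableT_comp => //; exact: measurable_funP.
pose B (e : R) := [set t | n%:R * (e * m1 / s) + 2 * L <= e * \sum_(i < n) phi i (X i t)].
have mB e : measurable (B e).
  rewrite (_ : B e = (fun t => e * \sum_(i < n) phi i (X i t)) @^-1`
    `[n%:R * (e * m1 / s) + 2 * L, +oo[%classic); last first.
    by apply/seteqP; split => t /=; rewrite in_itv/= andbT.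
  by rewrite -[X in measurable X]setTI; exact: measurable_funM.
pose A := [set t | `|s / n%:R * (\sum_(i < n) phi i (X i t)) - m1| <= 2 * L * s / n%:R].
(* By linearity the estimator is [s / n%:R] times the sum of the noise averages [phi]. *)
rewrite (_ : [set t | _] = A); last first.
  apply/seteqP; split => t /=;
    by rewrite (@fine_integral_scaled_sum _ _ _ P n (s / n%:R) 1 (fun i => h i (X i t))).
have mA : measurable A.
  rewrite (_ : A = (fun t => `|s / n%:R * (\sum_(i < n) phi i (X i t)) - m1|) @^-1`
    `]-oo, 2 * L * s / n%:R]%classic); last first.
    by apply/seteqP; split => t /=; rewrite in_itv.
  rewrite -[X in measurable X]setTI; apply: (measurableT_comp (@normr_measurable R setT)) => //.
  by apply: measurable_funB => //; exact: measurable_funM.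
(* Off both bad events the sum lies within [2 * L] of [n%:R * m1 / s]; multiplying by [s / n%:R]
   gives the radius. *)
have BA : ~` (B 1 `|` B (-1)) `<=` A.
  move=> t; rewrite /B /A /= => /not_orP[/negP + /negP].
  rewrite -!ltNge; set S := \sum_(i < n) _ => hp hn.
  have -> : s / n%:R * S - m1 = s / n%:R * (S - n%:R * m1 / s).
    by field; rewrite !gt_eqF.
  rewrite normrM ger0_norm; last by rewrite divr_ge0// ltW.
  rewrite (_ : 2 * L * s / n%:R = s / n%:R * (2 * L)); last by field; rewrite gt_eqF.
  rewrite ler_pM2l ?divr_gt0// ler_norml; apply/andP; split.
    by move: hn; rewrite !mulN1r mulNr mulrN mulrA; lra.
  by move: hp; rewrite !mul1r mulrA; lra.
have hp : (P (B 1%R) <= delta%:E)%E.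
  by apply: tail => [|y]; [rewrite expr1n|rewrite !mul1r expR_psi_le].
have hn : (P (B (-1)%R) <= delta%:E)%E.
  by apply: tail => [|y]; [rewrite sqrrN expr1n|rewrite !mulN1r expRN_psi_le].
(* Union bound: each tail costs [delta]. *)
apply: (@le_trans _ _ (P (~` (B 1 `|` B (-1))))); last first.
  have mC : measurable (~` (B 1 `|` B (-1))).
    by apply: measurableC; exact: (measurableU _ _ (mB 1) (mB (-1))).
  by apply: le_measure BA; apply/mem_set.
rewrite probability_setC; last exact: (measurableU _ _ (mB 1%R) (mB (-1)%R)).
rewrite EFinB leeB// (le_trans (measureU2 _ _ _))//.
by rewrite (_ : 2 * delta = delta + delta) ?EFinD ?leeD//; ring.
Qed.

End smoothed_mean.

(** * Tail integrals and the Gamma function *)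

Section tail_moments.
Context (R : realType).
Local Notation leb := (@lebesgue_measure R).

(** Layer-cake formula: the [q]-th power of [Z] exceeds [a] exactly when [Z] exceeds the [q]-th root
    of [a]. *)
Lemma integral_powR_tail d (T : measurableType d) (P : probability T R)
    (Z : {RV P >-> R}) (k q : R) :
  0 < k -> 0 < q -> (forall t, 0 <= Z t) ->
  (forall a, 0 <= a -> P [set t | a < Z t] = (expR (- (a `^ k)))%:E) ->
  (\int[P]_t (Z t `^ q)%:E =
   \int[leb]_(a in `[0%R, +oo[) (expR (- (a `^ (k / q))))%:E)%E.
Proof.
move=> k0 q0 Z0 tailZ.
have mY : measurable_fun setT (fun t => Z t `^ q).
  by apply: measurableT_comp (measurable_powR q) _; exact: measurable_funP.
pose Y : {RV P >-> R} := HB.pack (fun t => Z t `^ q) (isMeasurableFun.Build _ _ _ _ _ mY).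
have := @ge0_expectation_ccdf _ _ _ P Y (fun t => powR_ge0 _ _).
rewrite unlock => ->; apply: eq_integral => a /set_mem; rewrite /= in_itv/= andbT => a0.
have r0 : 0 <= a `^ q^-1 by exact: powR_ge0.
have aq : (a `^ q^-1) `^ q = a by rewrite -powRrM mulVf ?gt_eqF// powRr1.
rewrite mulrC powRrM -tailZ// /ccdf /distribution /pushforward.
congr (P _); apply/seteqP; split => t /=; rewrite in_itv/= andbT -[X in X < _ `^ _]aq.
  by rewrite ltNge => /negP h; rewrite ltNge; apply/negP => Za; apply: h;
    rewrite ge0_ler_powR// ?nnegrE// ltW.
by move=> h; rewrite gt0_ltr_powR ?nnegrE.
Qed.

(** The standard exponential law, whose density is the factor [expR (- t)] of the Gamma integral. *)
Let Q : probability (measurableTypeR R) R :=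
  exponential_distribution_exponential_prob__canonical__probability_measure_Probability
    (ltr01 : 0 < (1 : R)).

Let QE A : Q A = (\int[leb]_(x in A) (exponential_pdf 1 x)%:E)%E.
Proof. by []. Qed.

Let Q_tail (a : R) : 0 <= a -> Q `]a, +oo[%classic = (expR (- a))%:E.
Proof.
move=> a0; have Qa : Q `]-oo, a]%classic = (1 - expR (- a))%:E.
  have -> : Q `]-oo, a]%classic = exponential_prob 1 `[0, a]%classic.
    rewrite QE /exponential_prob [LHS]integral_mkcond [RHS]integral_mkcond.
    apply: eq_integral => t _; rewrite !patchE !mem_setE !in_itv/=.
    by case: (ltP t 0) => //= t0; rewrite lt0_exponential_pdf//; case: ifP.
  move: a0; rewrite le_eqVlt => /predU1P[<-|a0].
    by rewrite oppr0 expR0 subrr /exponential_prob set_itv1 integral_set1.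
  by rewrite exponential_prob_itv0c// mulN1r.
by rewrite -setCitvl probability_setC// Qa -EFinB opprB addrC subrK.
Qed.

(** Both sides are the [q]-th moment of a standard exponential variable, on the left through its
    density, on the right through its tails. *)
Lemma integral_powR_expRN (q : R) : 0 < q ->
  (\int[leb]_(t in `]0%R, +oo[) (t `^ q * expR (- t))%:E =
   \int[leb]_(a in `[0%R, +oo[) (expR (- (a `^ (1 / q))))%:E)%E.
Proof.
(* Clipping at 0 gives a variable that is nonnegative everywhere, as the tail formula requires, and
   changes nothing on the half-line of integration. *)
move=> q0; pose f (t : R) := (Num.max 0 t) `^ q.
have mmax : measurable_fun setT (fun t : measurableTypeR R => Num.max 0 (t : R) : R).
  by apply: (@measurable_maxr _ (measurableTypeR R) R setT (cst 0) idfun) => //;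
    move=> _ A mA; rewrite setTI.
transitivity (\int[leb]_t (exponential_pdf 1 t * f t)%:E)%E.
  rewrite integral_mkcond; apply: eq_integral => t _; rewrite patchE mem_setE in_itv/= andbT.
  have [t0|t0] := ltP 0 t.
    by rewrite exponential_pdfE ?ltW// /f max_r ?ltW// mul1r mulN1r mulrC.
  by rewrite /f max_l// powR0 ?gt_eqF// mulr0.
have mid : measurable_fun setT (idfun : measurableTypeR R -> R).
  by move=> _ A mA; rewrite setTI.
pose I : {RV Q >-> R} := HB.pack (idfun : measurableTypeR R -> R)
  (isMeasurableFun.Build _ _ (measurableTypeR R) R _ mid).
have mf : measurable_fun setT (f : R -> R).
  apply: measurableT_comp (measurable_powR q) _.
  by apply: (@measurable_maxr _ R R setT (cst 0) idfun).
rewrite (@ge0_integral_weighted_law _ (measurableTypeR R) R leb (distribution Q I) idfun _ 1)//;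
  last first.
- move=> B mB; rewrite mul1e -[RHS]/(Q B) QE [RHS]integral_mkcond; apply: eq_integral => t _.
  by rewrite patchE indicE; case: (t \in _); rewrite ?mulr1 ?mulr0.
- by move=> y; exact: powR_ge0.
- by move=> t; exact: exponential_pdf_ge0.
- exact: measurable_exponential_pdf.
rewrite mul1e ge0_integral_distribution//; last 2 first.
- exact/measurable_EFinP.
- by move=> y; rewrite lee_fin powR_ge0.
pose Z : {RV Q >-> R} := HB.pack (fun t : measurableTypeR R => Num.max 0 (t : R) : R)
  (isMeasurableFun.Build _ _ _ _ _ mmax).
rewrite -(@integral_powR_tail _ _ Q Z 1 q)//.
  by move=> t; rewrite le_max lexx.
move=> a a0; rewrite powRr1// -Q_tail//.
congr (Q _); apply/seteqP; split => t /=; rewrite in_itv/= andbT lt_max => h.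
  by case/orP: h => // /lt_le_trans/(_ a0); rewrite ltxx.
by rewrite h orbT.
Qed.

(** [Gamma] is a real-valued integral, which reads an infinite value as 0; being nonzero therefore
    certifies that the extended integral is finite. *)
Lemma Gamma_integral (z : R) : 1 < z -> Gamma z != 0 ->
  (\int[leb]_(a in `[0%R, +oo[) (expR (- (a `^ (1 / (z - 1)))))%:E = (Gamma z)%:E)%E.
Proof.
move=> z1; rewrite /Gamma /Rintegral -integral_powR_expRN ?subr_gt0//.
set I := integral _ _ _; rewrite -/I => In0.
by rewrite fineK//; case: I In0 => //=; rewrite eqxx.
Qed.

Lemma integral_expRN : (\int[leb]_(a in `[0%R, +oo[) (expR (- a))%:E = 1)%E.
Proof.
rewrite -(@integral_exponential_pdf R 1)// integral_mkcond; apply: eq_integral => t _.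
by rewrite /exponential_pdf !patchE; case: ifP => // _; rewrite mul1r mulN1r.
Qed.

End tail_moments.

(** * Moments of a Weibull variable *)

Section weibull_moments.
Context d (T : measurableType d) (R : realType) (P : probability T R).
Variables (e : {RV P >-> R}) (W : probability R R) (k sigma : R).
Hypotheses (k0 : 0 < k) (sigma0 : 0 < sigma) (weibW : is_weibull k sigma W).
Hypothesis eW : forall A, measurable A -> distribution P e A = W A.
Local Notation leb := (@lebesgue_measure R).

Let e_ge0 : P (e @^-1` `]-oo, 0[%classic) = 0%E.
Proof.
have : (distribution P e (~` `[0%R, +oo[) = 1 - distribution P e `[0%R, +oo[)%E.
  exact: probability_setC.
by rewrite (eW (measurable_itv `[0, +oo[)) weibW.1 subee// setCitvr.
Qed.

Let e_tail (a : R) : 0 <= a -> P (e @^-1` `]a, +oo[%classic) = (expR (- (a / sigma) `^ k))%:E.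
Proof.
move=> a0; have : (distribution P e (~` `]-oo, a]) = 1 - distribution P e `]-oo, a])%E.
  exact: probability_setC.
by rewrite (eW (measurable_itv `]-oo, a])) weibW.2// setCitvl -EFinB opprB addrC subrK.
Qed.

(** Division by [sigma] reduces the tail to that of unit scale, to which the tail formula applies
    with exponent [j]. *)
Lemma weibull_moment (j : nat) (m : R) : (0 < j)%N ->
  (\int[leb]_(a in `[0%R, +oo[) (expR (- (a `^ (k / j%:R))))%:E = m%:E)%E ->
  P.-integrable setT (EFin \o (fun t => e t ^+ j)) /\
  (\int[P]_t (e t ^+ j)%:E = (sigma ^+ j * m)%:E)%E.
Proof.
move=> j0 hm.
have me : measurable_fun setT e by exact: measurable_funP.
have mej : measurable_fun setT (EFin \o (fun t => e t ^+ j)).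
  by apply/measurable_EFinP; exact: measurable_funX.
(* The tail formula asks for a variable nonnegative everywhere; [e] is so only almost surely, hence
   the clipping at 0. *)
have mZ : measurable_fun setT (fun t => Num.max 0 (e t) / sigma).
  by apply: measurable_funM => //; exact: measurable_maxr.
pose Z : {RV P >-> R} := HB.pack (fun t => Num.max 0 (e t) / sigma)
  (isMeasurableFun.Build _ _ _ _ _ mZ).
have Z0 t : 0 <= Z t by rewrite /Z divr_ge0 ?le_max ?lexx ?(ltW sigma0).
have Ztail a : 0 <= a -> P [set t | a < Z t] = (expR (- (a `^ k)))%:E.
  move=> a0; have as0 : 0 <= a * sigma by rewrite mulr_ge0// ltW.
  rewrite -[in RHS](mulfK (negbT (gt_eqF sigma0)) a) -e_tail//.
  congr (P _); apply/seteqP; split => t /=; rewrite in_itv/= andbT ltr_pdivlMr// lt_max.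
    by case/orP => // /lt_le_trans/(_ as0); rewrite ltxx.
  by move=> ->; rewrite orbT.
have EZ : (\int[P]_t (Z t `^ j%:R)%:E = m%:E)%E.
  by rewrite (integral_powR_tail k0 _ Z0 Ztail) ?ltr0n.
have mZj : measurable_fun setT (fun t => Z t `^ j%:R).
  exact: measurableT_comp (measurable_powR _) mZ.
have iZ : P.-integrable setT (EFin \o (fun t => Z t `^ j%:R)).
  apply/integrableP; split; first exact/measurable_EFinP.
  under eq_integral do rewrite /= ger0_norm ?powR_ge0//.
  by rewrite EZ ltry.
pose f t : \bar R := ((sigma ^+ j)%:E * (Z t `^ j%:R)%:E)%E.
have if_ : P.-integrable setT f by exact: integrableZl.
have ae : ae_eq P setT (EFin \o (fun t => e t ^+ j)) f.
  exists (e @^-1` `]-oo, 0[%classic); split => //.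
    by rewrite -[X in measurable X]setTI; exact: measurable_funP.
  move=> t /= ; rewrite in_itv/=; apply: contra_notT; rewrite -leNgt => e0 _.
  by rewrite /f powR_mulrn// -EFinM -exprMn /= max_r// mulrC divfK// gt_eqF.
split.
  apply/integrableP; split => //.
  move/integrableP : if_ => [mf]; apply: le_lt_trans.
  rewrite le_eqVlt; apply/orP; left; apply/eqP.
  apply: ae_eq_integral => //; do ?exact: measurableT_comp.
  by move: ae; apply: filterS => t /[apply] ->.
rewrite (ae_eq_integral f)//; last by move/integrableP : if_ => [].
by rewrite integralZl// EZ EFinM.
Qed.

End weibull_moments.

(** * Transfer between variables and laws; moments from finite variance *)

Section laws.
Context (R : realType).

Lemma integral_law d (T : measurableType d) (P : probability T R)
    (Y : {RV P >-> R}) (mu : probability R R) (f : R -> R) :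
  (forall A, measurable A -> distribution P Y A = mu A) ->
  measurable_fun setT f -> mu.-integrable setT (EFin \o f) ->
  P.-integrable setT (EFin \o (fun t => f (Y t))) /\
  (\int[P]_t (f (Y t))%:E = \int[mu]_y (f y)%:E)%E.
Proof.
move=> Ymu mf fmu.
have mE : measurable_fun setT (EFin \o f) by exact/measurable_EFinP.
have mY : measurable_fun setT Y by exact: measurable_funP.
have eqi (g : R -> \bar R) : (\int[distribution P Y]_y g y = \int[mu]_y g y)%E.
  by apply: eq_measure_integral => A mA _; exact: Ymu.
have iY : P.-integrable setT (EFin \o (fun t => f (Y t))).
  apply/integrableP; split; first exact: measurableT_comp mE mY.
  have /integrableP[_] := fmu.
  by rewrite -eqi ge0_integral_distribution//; exact: measurableT_comp.
by split => //; rewrite -eqi integral_distribution.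
Qed.

(** Whatever real number [c] the mean is read as, finite variance makes [(x - c) ^+ 2] integrable,
    and a constant plus twice this square dominates both functions. *)
Lemma finite_variance_integrable (mu : probability R R) :
  ('V_mu[(idfun : R -> R)] < +oo)%E ->
  mu.-integrable setT (EFin \o (fun x : R => x)) /\
  mu.-integrable setT (EFin \o (fun x : R => x ^+ 2)).
Proof.
rewrite /variance unlock; set c := fine _ => hV.
have iq : mu.-integrable setT (EFin \o (fun x : R => (x - c) ^+ 2)).
  apply/integrableP; split.
    by apply/measurable_EFinP; apply: measurable_funX; exact: measurable_funB.
  apply: le_lt_trans hV; rewrite unlock le_eqVlt; apply/orP; left; apply/eqP.
  by apply: eq_integral => x _; rewrite /= ger0_norm ?sqr_ge0.
have dom (f : R -> R) (a : R) : measurable_fun setT f ->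
    (forall x, `|f x| <= a + 2 * (x - c) ^+ 2) -> mu.-integrable setT (EFin \o f).
  move=> mf fa; apply: (@le_integrable _ _ _ mu setT measurableT _
    ((EFin \o cst a) \+ (fun x => 2%:E * ((x - c) ^+ 2)%:E))%E).
  - exact/measurable_EFinP.
  - by move=> x _ /=; rewrite lee_fin (le_trans (fa x))// ler_norm.
  - apply: integrableD => //; first exact: finite_measure_integrable_cst.
    exact: integrableZl.
split.
  apply: (dom _ (1 + `|c|)) => // x.
  have h : `|x - c| <= 1 + (x - c) ^+ 2.
    by rewrite -(real_normK (num_real (x - c))); have := sqr_ge0 (`|x - c| - 1 / 2); nra.
  rewrite -[X in `|X| <= _](subrK c) (le_trans (ler_normD _ _))//.
  by have := sqr_ge0 (x - c); lra.
(* The gap in this domination is exactly [(x - 2 * c) ^+ 2]. *)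
apply: (dom _ (2 * c ^+ 2)); first exact: measurable_funX.
by move=> x; rewrite ger0_norm ?sqr_ge0//; have := sqr_ge0 (x - 2 * c); nra.
Qed.

End laws.

(** * Constants and the confidence level *)

Section parameters.
Context (R : realType).

Lemma Gamma_ge0 (z : R) : 0 <= Gamma z.
Proof. by apply: Rintegral_ge0 => t _; rewrite mulr_ge0 ?powR_ge0 ?expR_ge0. Qed.

(** With [y] the [k]-th power of the Gamma value, the constant is [y^-1 + ln y - 1], nonnegative by
    [1 + t <= expR t] at [t = - ln y]. *)
Lemma weibull_c_ge0 (k : R) : 0 < Gamma (1 + 1 / k) -> 0 <= weibull_c k.
Proof.
move=> G0; rewrite /weibull_c -ln_powR; set y := _ `^ _.
have y0 : 0 < y by exact: powR_gt0.
have := expR_ge1Dx (- ln y); rewrite expRN lnK ?posrE//; lra.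
Qed.

(** The left side equals [expR (- c) * delta]; [c] is 0 for additive noise and [weibull_c k] for
    multiplicative noise. *)
Lemma expRN_ln_inv (c delta : R) : 0 < delta -> 0 <= c ->
  expR (- (c + ln delta^-1)) <= delta.
Proof.
move=> d0 c0; rewrite lnV ?posrE// -[leRHS]lnK ?posrE// ler_expR; lra.
Qed.

Lemma ln_inv_gt0 (delta : R) : 0 < delta < 1 -> 0 < ln delta^-1.
Proof. by move=> /andP[d0 d1]; rewrite ln_gt0// invf_gt1. Qed.

End parameters.

(** * First two moments of the noise and of the noisy datum *)

Section noise_moments.
Context d (T : measurableType d) (R : realType) (P : probability T R).

(** With the data frozen, a noisy datum is affine in the noise. *)
Lemma has_moments_affine (Y : T -> R) (y1 y2 a b : R) : has_moments P Y y1 y2 ->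
  has_moments P (fun t => a + b * Y t) (a + b * y1) (a ^+ 2 + 2 * a * b * y1 + b ^+ 2 * y2).
Proof.
move=> Ymom.
have [i1 E1] := @integral_quadratic _ _ _ P Y y1 y2 a b 0 Ymom.
have [i2 E2] := @integral_quadratic _ _ _ P Y y1 y2 (a ^+ 2) (2 * a * b) (b ^+ 2) Ymom.
have e1 : (fun t => a + b * Y t + 0 * Y t ^+ 2) = (fun t => a + b * Y t).
  by apply/funext => t; ring.
have e2 : (fun t => a ^+ 2 + 2 * a * b * Y t + b ^+ 2 * Y t ^+ 2) =
    (fun t => (a + b * Y t) ^+ 2).
  by apply/funext => t; ring.
rewrite e1 in i1; rewrite e2 in i2; split => //.
- transitivity (a + b * y1 + 0 * y2)%:E; last by congr EFin; ring.
  by rewrite -E1; apply: eq_integral => t _; congr EFin; ring.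
- by rewrite -E2; apply: eq_integral => t _; congr EFin; ring.
Qed.

Lemma weibull_has_moments (e : {RV P >-> R}) (W : probability R R) (k sigma m1 m2 : R) :
  0 < k -> 0 < sigma -> is_weibull k sigma W ->
  (forall A, measurable A -> distribution P e A = W A) ->
  (\int[lebesgue_measure]_(a in `[0%R, +oo[) (expR (- (a `^ k)))%:E = m1%:E)%E ->
  (\int[lebesgue_measure]_(a in `[0%R, +oo[) (expR (- (a `^ (k / 2))))%:E = m2%:E)%E ->
  has_moments P e (sigma * m1) (sigma ^+ 2 * m2).
Proof.
move=> k0 s0 weibW eW h1 h2.
have [|i1 E1] := @weibull_moment _ _ _ P e W k sigma k0 s0 weibW eW 1 m1 isT.
  by rewrite divr1.
have [|i2 E2] := @weibull_moment _ _ _ P e W k sigma k0 s0 weibW eW 2 m2 isT.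
  exact: h2.
by split.
Qed.

(** For shape 2 the first moment is a half-line Gaussian integral and the second an exponential one;
    the variance is then [sigma ^+ 2 * (1 - pi / 4)]. *)
Lemma weibull2_has_moments (e : {RV P >-> R}) (W : probability R R) (sigma : R) :
  0 < sigma -> is_weibull 2 sigma W ->
  (forall A, measurable A -> distribution P e A = W A) ->
  has_moments P e (sigma * (Num.sqrt pi / 2)) (sigma ^+ 2 * 1).
Proof.
move=> s0 weibW eW; apply: (weibull_has_moments _ s0 weibW eW) => //.
- rewrite -integral0y_gauss; apply: eq_integral => a /set_mem.
  by rewrite /= in_itv/= andbT => a0; rewrite powR_mulrn.
- rewrite -[RHS](@integral_expRN R); apply: eq_integral => a /set_mem.
  by rewrite /= in_itv/= andbT => a0; rewrite divff// powRr1.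
Qed.

(** At [z = 1 + j / k] the exponent [1 / (z - 1)] of the Gamma tail integral is [k / j], here for
    [j] equal to 1 and 2. *)
Lemma weibullk_has_moments (e : {RV P >-> R}) (W : probability R R) (k sigma : R) :
  0 < k -> 0 < sigma -> is_weibull k sigma W ->
  (forall A, measurable A -> distribution P e A = W A) ->
  Gamma (1 + 1 / k) != 0 :> R -> Gamma (1 + 2 / k) != 0 :> R ->
  has_moments P e (sigma * Gamma (1 + 1 / k)) (sigma ^+ 2 * Gamma (1 + 2 / k)).
Proof.
move=> k0 s0 weibW eW G1 G2; apply: (weibull_has_moments k0 s0 weibW eW).
- rewrite -(@Gamma_integral R (1 + 1 / k) _ G1); last by rewrite ltrDl divr_gt0.
  by apply: eq_integral => a _; rewrite [1 + _]addrC addrK !div1r invrK.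
- rewrite -(@Gamma_integral R (1 + 2 / k) _ G2); last by rewrite ltrDl divr_gt0.
  by apply: eq_integral => a _; rewrite [1 + _]addrC addrK div1r invf_div.
Qed.

End noise_moments.

(** * Deviation bounds for the additive and multiplicative estimators *)

Theorem proposition9 (R : realType) (d : measure_display)
    (T : measurableType d) (P : probability T R)
    (n : nat) (X : 'I_n -> {RV P >-> R})
    (mu : probability R R) (delta : R) :
  (0 < n)%N ->
  mutually_independent P (fun i => X i : T -> R) ->
  (forall i A, measurable A -> distribution P (X i) A = mu A) ->
  ('V_mu[(idfun : R -> R)] < +oo)%E ->
  0 < delta < 1 ->
  let EX : R := fine ('E_mu[(fun x : R => x)%R])%E in
  let EX2 : R := fine ('E_mu[(fun x : R => x ^+ 2)%R])%E in
  (forall (sigma s : R) (W : probability R R)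
      (eps : 'I_n -> {RV P >-> R}),
    0 < sigma -> 0 < s ->
    is_weibull 2 sigma W ->
    (forall i A, measurable A ->
      distribution P (eps i) A =
      pushforward W (fun w : R => w - sigma * Num.sqrt pi / 2) A) ->
    mutually_independent P (fun i => eps i : T -> R) ->
    independent_families P (fun i => X i : T -> R) (fun i => eps i : T -> R) ->
    s ^+ 2 = n%:R * (EX2 + sigma ^+ 2 * (1 - pi / 4)) / (2 * ln (delta^-1)) ->
    ((1 - 2 * delta)%:E <=
     P [set t | `| est_add P (fun i => X i) (fun i => eps i) s t - EX | <=
       Num.sqrt (2 * (EX2 + sigma ^+ 2 * (1 - pi / 4)) * ln (delta^-1)
                 / n%:R)]%R)%E)
  /\
  (0 < EX2 ->
   forall (k s : R) (W : probability R R)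
      (eps : 'I_n -> {RV P >-> R}),
    0 < k -> 0 < s ->
    is_weibull k (Gamma (1 + 1 / k))^-1 W ->
    (forall i A, measurable A -> distribution P (eps i) A = W A) ->
    mutually_independent P (fun i => eps i : T -> R) ->
    independent_families P (fun i => X i : T -> R) (fun i => eps i : T -> R) ->
    s ^+ 2 = n%:R * Gamma (1 + 2 / k) * EX2 /
             (2 * Gamma (1 + 1 / k) ^+ 2 * (weibull_c k + ln (delta^-1))) ->
    ((1 - 2 * delta)%:E <=
     P [set t | `| est_mul P (fun i => X i) (fun i => eps i) s t - EX | <=
       Num.sqrt (2 * Gamma (1 + 2 / k) * EX2 * (weibull_c k + ln (delta^-1))
                 / (Gamma (1 + 1 / k) ^+ 2 * n%:R))]%R)%E).
Proof.
move=> n0 indX Xmu Vmu /[dup] d01 /andP[d0 _] EX EX2.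
have lnd := ln_inv_gt0 d01.
have [imu imu2] := finite_variance_integrable Vmu.
have mid : measurable_fun setT (fun x : R => x) by [].
have msq : measurable_fun setT (fun x : R => x ^+ 2) by exact: measurable_funX.
have EXE : (\int[mu]_x x%:E = EX%:E)%E.
  by rewrite /EX unlock fineK// (integrable_fin_num measurableT imu).
have EX2E : (\int[mu]_x (x ^+ 2)%:E = EX2%:E)%E.
  by rewrite /EX2 unlock fineK// (integrable_fin_num measurableT imu2).
have Xmom i : has_moments P (X i) EX EX2.
  have [? ?] := integral_law (Xmu i) mid imu.
  by have [? ?] := integral_law (Xmu i) msq imu2; split=> //; rewrite -?EXE -?EX2E.
split.
- move=> sigma s W eps sigma0 s0 weibW epsW _ _ sE.
  (* [c] is the mean of the Weibull law; adding it back to the centred noise gives a variable [e i]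
     of law [W]. *)
  set c := sigma * Num.sqrt pi / 2 in epsW.
  have meps i : measurable_fun setT (eps i) by exact: measurable_funP.
  have me i : measurable_fun setT (fun t => eps i t + c) by exact: measurable_funD.
  pose e i : {RV P >-> R} := HB.pack (fun t => eps i t + c) (isMeasurableFun.Build _ _ _ _ _ (me i)).
  have eW i A : measurable A -> distribution P (e i) A = W A.
    move=> mA; have mB : measurable ((fun y : R => y + c) @^-1` A).
      by rewrite -[X in measurable X]setTI; exact: measurable_funD.
    transitivity (distribution P (eps i) ((fun y : R => y + c) @^-1` A)); first by [].
    rewrite epsW// /pushforward; congr (W _); apply/seteqP.
    by split => w /=; rewrite subrK.
  (* The noisy datum is [x - c] plus a Weibull variable of mean [c], so its second moment exceeds
     [x ^+ 2] by the Weibull variance. *)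
  have umom i x : has_moments P (fun t => x + eps i t) x (1 * x ^+ 2 + sigma ^+ 2 * (1 - pi / 4)).
    have := has_moments_affine (x - c) 1 (weibull2_has_moments sigma0 weibW (eW i)).
    have -> : (fun t => x - c + 1 * e i t) = (fun t => x + eps i t).
      by apply/funext => t /=; ring.
    have -> : x - c + 1 * (sigma * (Num.sqrt pi / 2)) = x by rewrite /c; ring.
    congr (has_moments _ _ _ _).
    have pE : pi = Num.sqrt pi ^+ 2 :> R by rewrite sqr_sqrtr// pi_ge0.
    by rewrite [in RHS]pE /c; field.
  have := @smoothed_mean_deviation _ _ _ P n X (fun i x t => x + eps i t)
    EX EX2 1 (sigma ^+ 2 * (1 - pi / 4)) s (ln delta^-1) delta.
  rewrite mul1r /est_add expectation.unlock; apply => //.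
  + by rewrite -[ln _]add0r expRN_ln_inv.
  + by move=> i; apply: measurable_funD => //; exact: measurableT_comp.
- move=> EX2_0 k s W eps k0 s0 weibW epsW _ _ sE.
  set G1 := Gamma (1 + 1 / k) in weibW sE *.
  set G2 := Gamma (1 + 2 / k) in sE *.
  set L := weibull_c k + ln delta^-1 in sE *.
  (* Degenerate Gamma values make the right-hand side of [sE] vanish. *)
  have s2 : s ^+ 2 != 0 by rewrite sqrf_eq0 gt_eqF.
  have G1n0 : G1 != 0 by apply: contraNneq s2; rewrite sE => ->; rewrite expr0n/= mulr0 mul0r invr0 mulr0.
  have G2n0 : G2 != 0 by apply: contraNneq s2; rewrite sE => ->; rewrite mulr0 !mul0r.
  have G1_0 : 0 < G1 by rewrite lt_neqAle eq_sym G1n0 Gamma_ge0.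
  have c0 : 0 <= weibull_c k by exact: weibull_c_ge0.
  have L0 : 0 < L by rewrite ltr_wpDl.
  have meps i : measurable_fun setT (eps i) by exact: measurable_funP.
  (* The scale [G1^-1] gives the noise mean 1 and second moment [G2 / G1 ^+ 2], so the mean [x] is
     kept and the constant term is 0. *)
  have umom i x : has_moments P (fun t => x * eps i t) x (G2 / G1 ^+ 2 * x ^+ 2 + 0).
    have iG1 : 0 < G1^-1 by rewrite invr_gt0.
    have := has_moments_affine 0 x (weibullk_has_moments k0 iG1 weibW (epsW i) G1n0 G2n0).
    have -> : (fun t => 0 + x * eps i t) = (fun t => x * eps i t).
      by apply/funext => t; rewrite add0r.
    rewrite -/G1 -/G2 (_ : 0 + x * (G1^-1 * G1) = x); last by field.
    by congr (has_moments _ _ _ _); field.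
  have := @smoothed_mean_deviation _ _ _ P n X (fun i x t => x * eps i t)
    EX EX2 (G2 / G1 ^+ 2) 0 s L delta.
  rewrite /est_mul expectation.unlock.
  have -> : 2 * (G2 / G1 ^+ 2 * EX2 + 0) * L / n%:R = 2 * G2 * EX2 * L / (G1 ^+ 2 * n%:R).
    by field; rewrite pnatr_eq0 -lt0n n0 G1n0.
  apply => //.
  + by rewrite expRN_ln_inv.
  + by move=> i; apply: measurable_funM => //; exact: measurableT_comp.
  + by rewrite sE; field; rewrite G1n0 gt_eqF.
Qed.
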